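(* Let $H_1$ and $H_2$ be tournaments such that one of the following holds: (i) one of them is a left nebula and the other is a right nebula; (ii) one of them is a left nebula and the other is a central nebula; (iii) one of them is a right nebula and the other is a central nebula. Then $\{H_1,H_2\}$ has the Erdős–Hajnal property; that is, there exists a constant $\kappa>0$ (depending only on $H_1,H_2$) such that every tournament $T$ that contains neither $H_1$ nor $H_2$ has a transitive subtournament of order at least $|T|^{\kappa}$.
   Context: All graphs and tournaments are finite and simple. A tournament is a directed graph in which for every two distinct vertices $u,v$ exactly one of $(u,v),(v,u)$ is an edge; $|T|$ denotes the number of vertices of $T$ (its order). A tournament is transitive if it has no directed cycle. A tournament $T$ contains a tournament $S$ if $S$ is isomorphic to the subtournament $T|X$ induced by some $X\subseteq V(T)$; otherwise $T$ is $S$-free. Let $\theta=(v_1,\dots,v_{|T|})$ be an ordering of the vertices of a tournament $T$. An edge $(v_j,v_i)$ of $T$ is a backward edge under $\theta$ if $i<j$. The graph of backward edges $B(T,\theta)$ is the undirected graph on $V(T)$ in which $v_iv_j$ is an edge if and only if $(v_i,v_j)$ or $(v_j,v_i)$ is a backward edge of $T$ under $\theta$. A three-vertex star is the graph $K_{1,2}$; its center is the vertex of degree 2. A connected component of $B(T,\theta)$ that is a three-vertex star is called a left star if its center precedes both other vertices in $\theta$, a right star if its center comes after both other vertices in $\theta$, and a central star if its center lies between the other two vertices in $\theta$. A tournament $T$ is a left nebula (respectively right nebula, central nebula) if there is an ordering $\theta$ of its vertices such that every connected component of $B(T,\theta)$ is either a three-vertex left star (respectively right star, central star) or a single vertex.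 *)

(* Defs.v *)
From mathcomp Require Import all_boot.

Set Implicit Arguments.
Unset Strict Implicit.
Unset Printing Implicit Defensive.

Record tournament := Tournament {
  vertex :> finType;
  arc : rel vertex;
  arc_irr : irreflexive arc;
  arc_tour : forall u v : vertex, u != v -> arc u v (+) arc v u
}.

Arguments arc {t} u v.

Definition isomorphic (S T : tournament) : Prop :=
  exists f : S -> T, bijective f /\ forall u v : S, arc (f u) (f v) = arc u v.

Section Induced.

Variables (T : tournament) (X : {set T}).

Definition induced_arc : rel {x : T | x \in X} :=
  fun u v => arc (val u) (val v).

Lemma induced_arc_irr : irreflexive induced_arc.
Proof. by move=> u; apply: arc_irr. Qed.

Lemma induced_arc_tour (u v : {x : T | x \in X}) :
  u != v -> induced_arc u v (+) induced_arc v u.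
Proof. by move=> neq_uv; apply: arc_tour; rewrite val_eqE. Qed.

Definition induced : tournament := Tournament induced_arc_irr induced_arc_tour.

End Induced.

Definition contains (T S : tournament) : Prop :=
  exists X : {set T}, isomorphic S (induced X).

(* [ucycle] also accepts the empty sequence, which is not a directed cycle. *)
Definition transitive_tournament (T : tournament) : Prop :=
  forall c : seq T, ucycle (@arc T) c -> c = [::].

Section Backward.

Variable T : tournament.

Definition is_ordering (theta : seq T) : Prop :=
  uniq theta /\ forall v : T, v \in theta.

Variable theta : seq T.

Definition precedes (u v : T) : bool := index u theta < index v theta.

Definition backward_edge (u v : T) : bool := arc u v && precedes v u.

Definition backward_graph : rel T :=
  fun u v => backward_edge u v || backward_edge v u.

Definition is_component (C : {set T}) : Prop :=
  exists v : T, C = [set u | connect backward_graph v u].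

(* The subgraph of the backward graph induced on C is K_{1,2}, with center c
   and leaves a and b. *)
Definition star3 (C : {set T}) (c a b : T) : Prop :=
  [/\ C = [set c; a; b], uniq [:: c; a; b],
      backward_graph c a, backward_graph c b & ~~ backward_graph a b].

Definition left_star (C : {set T}) : Prop :=
  exists c a b : T, [/\ star3 C c a b, precedes c a & precedes c b].

Definition right_star (C : {set T}) : Prop :=
  exists c a b : T, [/\ star3 C c a b, precedes a c & precedes b c].

(* The two leaves play symmetric roles, so a may be taken to be the first. *)
Definition central_star (C : {set T}) : Prop :=
  exists c a b : T, [/\ star3 C c a b, precedes a c & precedes c b].

End Backward.

Definition nebula (star : forall T : tournament, seq T -> {set T} -> Prop)
    (T : tournament) : Prop :=
  exists theta : seq T, is_ordering theta /\
    forall C : {set T}, is_component theta C ->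
      star T theta C \/ exists v : T, C = [set v].

Definition left_nebula : tournament -> Prop := nebula left_star.
Definition right_nebula : tournament -> Prop := nebula right_star.
Definition central_nebula : tournament -> Prop := nebula central_star.

(* Main.v *)
Require Import Defs.
From mathcomp Require Import all_boot all_order all_algebra.
From mathcomp Require Import reals exp zify lra.

(* [arc] of mathcomp's path library would otherwise shadow [Defs.arc]. *)
Import Defs.

(* The pair {H1, H2} even has the strong Erdos-Hajnal property: every
   {H1, H2}-free tournament contains a complete pair A => B of linear-sized
   sets.  A transitive subtournament of polynomial size then follows by
   recursion inside A and B.

   To find the complete pair, greedy embedding of H1 yields a long sequence of
   linear-sized sets in which every vertex has few backward edges towards each
   other set.  Passing to subsets, every triple of these sets may be assumed,
   for each kind of star, either to contain no such star or to contain one in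
   all large subsets.  If a triple X, Y, Z contains no star of two of the three
   kinds, then for two of its sets every backward edge joins vertices with the
   same backward neighbourhood in the third set, and sorting the vertices by
   these neighbourhoods produces a complete pair.  Otherwise Ramsey's theorem
   gives many sets all of whose triples are rich in one kind of star, and the
   corresponding nebula is embedded one component at a time. *)

Set Implicit Arguments.
Unset Strict Implicit.
Unset Printing Implicit Defensive.

(** * Ramsey's theorem for pairs and triples of a sequence *)

(** Subsequences keep the order, so [r] need not be symmetric. Double induction on [k] and [l]: in
    the tail after [x], either the [y] with [r x y] or the others are numerous, and [x] is prepended
    to what is found there when the colours agree. *)
Lemma ramsey2 (k l : nat) : exists N, forall (I : eqType) (r : rel I) (s : seq I),
  N <= size s -> exists s', subseq s' s /\
    ((k <= size s' /\ pairwise r s') \/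
     (l <= size s' /\ pairwise (fun x y => ~~ r x y) s')).
Proof.
elim: k l => [|k IHk] l.
  by exists 0 => I r s _; exists [::]; split; [exact: sub0seq | left].
elim: l => [|l [N2 IHl]].
  by exists 0 => I r s _; exists [::]; split; [exact: sub0seq | right].
have [N1 {}IHk] := IHk l.+1.
exists (N1 + N2).+1 => I r [|x s] //=; rewrite ltnS => le_s.
have := count_predC (r x) s; rewrite -!size_filter => size_s.
have [le1|lt1] := leqP N1 (size (filter (r x) s)).
  have [s' [sub_s' [[ks' rs']|[ls' rs']]]] := IHk I r _ le1.
    exists (x :: s'); split; first by rewrite /= eqxx (subseq_trans sub_s') ?filter_subseq.
    left; split=> //=; rewrite rs' andbT; apply/allP => y ys'.
    by have := mem_subseq sub_s' ys'; rewrite mem_filter => /andP[].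
  exists s'; split; last by right.
  exact: subseq_trans (subseq_trans sub_s' (filter_subseq _ _)) (subseq_cons _ _).
have le2 : N2 <= size (filter (predC (r x)) s) by lia.
have [s' [sub_s' [[ks' rs']|[ls' rs']]]] := IHl I r _ le2.
  exists s'; split; last by left.
  exact: subseq_trans (subseq_trans sub_s' (filter_subseq _ _)) (subseq_cons _ _).
exists (x :: s'); split; first by rewrite /= eqxx (subseq_trans sub_s') ?filter_subseq.
right; split=> //=; rewrite rs' andbT; apply/allP => y ys'.
by have := mem_subseq sub_s' ys'; rewrite mem_filter => /andP[].
Qed.

Definition on_triples (I : eqType) (P : I -> I -> I -> bool) (s : seq I) :=
  forall a b c, subseq [:: a; b; c] s -> P a b c.

Lemma pairwise_subseq2 (I : eqType) (r : rel I) (s : seq I) b c :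
  pairwise r s -> subseq [:: b; c] s -> r b c.
Proof. by move=> rs /subseq_pairwise/(_ rs) /=; rewrite !andbT. Qed.

Lemma on_triples_cons (I : eqType) (P : I -> I -> I -> bool) x s :
  pairwise (P x) s -> on_triples P s -> on_triples P (x :: s).
Proof.
move=> Px Ps a b c /=; case: eqP => [-> bc|_]; last exact: Ps.
exact: pairwise_subseq2 bc.
Qed.

(** Applying [ramsey2] to the colouring [P x] of the pairs of the tail makes all triples starting
    with [x] alike; the induction continues inside the surviving tail [t]. *)
Lemma ramsey3 (k l : nat) :
  exists N, forall (I : eqType) (P : I -> I -> I -> bool) (s : seq I),
  N <= size s -> exists s', subseq s' s /\
    ((k <= size s' /\ on_triples P s') \/
     (l <= size s' /\ on_triples (fun x y z => ~~ P x y z) s')).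
Proof.
elim: k l => [|k IHk] l.
  by exists 0 => I r s _; exists [::]; split; [exact: sub0seq | left].
elim: l => [|l [N2 IHl]].
  by exists 0 => I r s _; exists [::]; split; [exact: sub0seq | right].
have [N1 {}IHk] := IHk l.+1.
have [N hN] := ramsey2 N1 N2.
exists N.+1 => I P [|x s] //=; rewrite ltnS => le_s.
have [t [sub_t [[le_t pt]|[le_t pt]]]] := hN I (P x) s le_s.
- have [s' [sub_s' [[ks' rs']|[ls' rs']]]] := IHk I P _ le_t.
    exists (x :: s'); split; first by rewrite /= eqxx (subseq_trans sub_s').
    by left; split=> //; apply: on_triples_cons => //; apply: subseq_pairwise pt.
  exists s'; split; last by right.
  exact: subseq_trans (subseq_trans sub_s' sub_t) (subseq_cons _ _).
- have [s' [sub_s' [[ks' rs']|[ls' rs']]]] := IHl I P _ le_t.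
    exists s'; split; last by left.
    exact: subseq_trans (subseq_trans sub_s' sub_t) (subseq_cons _ _).
  exists (x :: s'); split; first by rewrite /= eqxx (subseq_trans sub_s').
  right; split=> //.
  by apply: (@on_triples_cons _ (fun x y z => ~~ P x y z)) => //; apply: subseq_pairwise pt.
Qed.

(** * Embeddings, smooth pairs and counting tools *)

Lemma arcC (T : tournament) (u v : T) : u != v -> arc v u = ~~ arc u v.
Proof. by move/arc_tour; case: (arc u v); case: (arc v u). Qed.

(** Preserving arcs forces injectivity: distinct vertices of [H] are joined by an arc, while [arc]
    is irreflexive in [T]. *)
Lemma contains_embedding (T H : tournament) (f : H -> T) :
  (forall u v, arc (f u) (f v) = arc u v) -> contains T H.
Proof.
move=> fE; exists [set f u | u : H].
have finj : injective f.
  move=> u v fuv; apply/eqP/negPn/negP => neq_uv.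
  have := arc_tour neq_uv; rewrite -!fE fuv !arc_irr; by [].
have fX u : f u \in [set f u | u : H] by apply: imset_f.
exists (fun u => Sub (f u) (fX u)); split; last by move=> u v; exact: fE.
have gX (y : {x : T | x \in [set f u | u : H]}) : exists u, f u == val y.
  by have /imsetP[u _ yu] := valP y; exists u; rewrite yu.
exists (fun y => xchoose (gX y)) => [u|y].
  by apply: finj; apply/eqP; exact: (xchooseP (gX (Sub (f u) (fX u)))).
by apply: val_inj => /=; apply/eqP; exact: (xchooseP (gX y)).
Qed.

(** [A] is meant to precede [B], so the arcs counted are the backward ones; every vertex meets at
    most a fraction [1/L] of the other set through them. *)
Definition smooth (T : tournament) (L : nat) (A B : {set T}) : Prop :=
  [/\ [disjoint A & B],
      forall a, a \in A -> L * #|[set b in B | arc b a]| <= #|B| &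
      forall b, b \in B -> L * #|[set a in A | arc b a]| <= #|A|].

Lemma smooth_sub (T : tournament) (L D : nat) (A B A' B' : {set T}) :
  0 < D -> smooth (L * D) A B -> A' \subset A -> B' \subset B ->
  #|A| <= D * #|A'| -> #|B| <= D * #|B'| -> smooth L A' B'.
Proof.
move=> D0 [dAB hA hB] sA sB cA cB; split.
- by apply: disjointWl sA _; apply: disjointWr sB _.
- move=> a /(subsetP sA) /hA h; rewrite -(leq_pmul2l D0).
  apply: leq_trans cB; apply: leq_trans h.
  rewrite mulnA [D * L]mulnC leq_mul2l; apply/orP; right.
  by apply/subset_leq_card/subsetP => y; rewrite !inE => /andP[/(subsetP sB) -> ->].
- move=> b /(subsetP sB) /hB h; rewrite -(leq_pmul2l D0).
  apply: leq_trans cA; apply: leq_trans h.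
  rewrite mulnA [D * L]mulnC leq_mul2l; apply/orP; right.
  by apply/subset_leq_card/subsetP => y; rewrite !inE => /andP[/(subsetP sA) -> ->].
Qed.

Lemma cover_pigeonhole (I : eqType) (T : finType) (s : seq I) (A : {set T})
    (X : I -> {set T}) :
  (forall a, a \in A -> exists2 i, i \in s & a \in X i) -> A != set0 ->
  exists2 i, i \in s & #|A| <= size s * #|X i|.
Proof.
move=> cov /set0Pn[a0 a0A].
have [/hasP[i is_ hi]|/hasPn no] := boolP (has (fun i => #|A| <= size s * #|X i|) s).
  by exists i.
have le_sum : #|A| <= \sum_(i <- s) #|X i|.
  clear -cov; elim: s A cov => [|i s IH] A cov.
    rewrite big_nil leqn0 cards_eq0; apply/eqP/setP => a; rewrite inE.
    by apply/negP => /cov[].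
  rewrite big_cons -(cardsID (X i) A) leq_add ?subset_leq_card ?subsetIr //.
  apply: IH => a; rewrite inE => /andP[naX /cov[j]].
  by rewrite inE => /orP[/eqP->|js] aj; [rewrite aj in naX | exists j].
have [i0 i0s _] := cov _ a0A.
have s0 : 0 < size s by case: (s) i0s.
have A0 : 0 < #|A| by apply/card_gt0P; exists a0.
(* If every [i] fails, [size s * #|X i| <= #|A|.-1]; summing over [s] contradicts [le_sum]. *)
suff : size s * #|A| <= size s * #|A|.-1 by rewrite leq_pmul2l //; lia.
apply: leq_trans (_ : size s * \sum_(i <- s) #|X i| <= _); first by rewrite leq_mul2l le_sum orbT.
rewrite big_distrr /= -sum1_size big_distrl /= big_seq [leqRHS]big_seq.
apply: leq_sum => i /no; rewrite sum1_size mul1n; lia.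
Qed.

Lemma double_count (T : finType) (r : rel T) (X Y : {set T}) :
  \sum_(x in X) #|[set y in Y | r x y]| = \sum_(y in Y) #|[set x in X | r x y]|.
Proof.
under eq_bigr do rewrite -sum1dep_card big_mkcondr /=.
rewrite exchange_big /=.
by under eq_bigr do rewrite -big_mkcondr sum1dep_card.
Qed.

Lemma disjoint_family (I : eqType) (T : finType) (m : nat) (s : seq I) (X : {set T}) :
  size s * m <= #|X| ->
  exists A : I -> {set T}, (forall i, i \in s -> A i \subset X /\ #|A i| = m) /\
    {in s &, forall i j, i != j -> [disjoint A i & A j]}.
Proof.
elim: s X => [|i s IH] X hX; first by exists (fun _ => set0).
have : m <= #|X| by apply: leq_trans hX; rewrite /= mulSn leq_addr.
move=> /card_geqP[t [ut st sub_t]].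
pose B := [set x in t].
have sB : B \subset X by apply/subsetP => x; rewrite inE => /sub_t.
have cB : #|B| = m by rewrite cardsE (card_uniqP ut).
have [|A [hA dA]] := IH (X :\: B).
  by rewrite cardsD (setIidPr sB) cB; move: hX; rewrite /= mulSn; lia.
exists (fun j => if j == i then B else A j); split.
  move=> j; rewrite inE; case: eqP => //= _ /hA[sA ->]; split=> //.
  by apply: subset_trans sA _; exact: subsetDl.
have dB j : j \in s -> [disjoint B & A j].
  move=> /hA[sA _]; rewrite disjoint_sym; apply: disjointWl sA _.
  by rewrite -setI_eq0; apply/eqP/setP => x; rewrite !inE; case: (x \in t); rewrite ?andbF.
move=> j k; rewrite !inE.
case: eqP => [->|_] /=; case: eqP => [->|_] //=; rewrite ?eqxx //.
- by move=> _ ks _; apply: dB.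
- by move=> js _ _; rewrite disjoint_sym; apply: dB.
- exact: dA.
Qed.

(** * Greedy embedding and chains of smooth sets *)

(** Vertices are embedded one at a time. An image [a] of [v] is good if, for every later [u], more
    than a fraction [1/L] of [A u] is joined to [a] as [u] is to [v]; these parts become the new
    blocks, which turns [D] into [D * L]. If no [a] is good, a single [u] is to blame for a linear
    part of [A v], and this gives the sparse pair. *)
Lemma greedy_embedding (H : tournament) (L : nat) (s : seq H) (D : nat) : uniq s ->
  exists C, forall (T : tournament) (x0 : T) (A : H -> {set T}) m, 0 < m ->
  (forall v, v \in s -> m <= D * #|A v|) ->
  {in s &, forall u v, u != v -> [disjoint A u & A v]} ->
  (exists f : H -> T, {in s, forall v, f v \in A v} /\
     {in s &, forall u v, arc (f u) (f v) = arc u v}) \/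
  exists (u v : H) (X Y : {set T}) (b : bool), [/\ [/\ u \in s, v \in s & u != v],
    X \subset A u, Y \subset A v, m <= C * #|X| /\ m <= C * #|Y| &
    forall x, x \in X -> L * #|[set y in Y | arc x y == b]| <= #|Y|].
Proof.
elim: s D => [|v s IH] D /=.
  by move=> _; exists 0 => T x0 A m _ _ _; left; exists (fun _ => x0); split.
move=> /andP[vs us]; have [C hC] := IH (D * L) us.
(* The first term serves the recursion; the second covers [X u], which loses a factor [size s] by
   pigeonhole, and [A u], for which [D] is enough. *)
exists (maxn C (D * (size s).+1)) => T x0 A m m0 hA dA.
have neq u : u \in s -> v != u by move=> us'; apply: contraNneq vs => ->.
have dvA u : u \in s -> [disjoint A v & A u].
  by move=> us'; apply: dA; rewrite ?inE ?eqxx ?us' ?orbT ?neq.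
pose N u a := [set y in A u | arc a y == arc v u].
have NA u a : N u a \subset A u by apply/subsetP => y; rewrite inE => /andP[].
have [/existsP[a /andP[aA /allP hN]]|no] :=
    boolP [exists a, (a \in A v) && all (fun u => #|A u| < L * #|N u a|) s].
  have [u us'|u w us' ws uw||] := hC T x0 (fun u => N u a) m m0.
  - rewrite -mulnA (leq_trans (hA u _)) ?inE ?us' ?orbT // leq_mul2l ltnW ?orbT //.
    exact: hN.
  - apply: disjointWl (NA _ _) _; apply: disjointWr (NA _ _) _.
    by apply: dA; rewrite ?inE ?us' ?ws ?orbT.
  - move=> [f [fN fE]]; left; exists (fun u => if u == v then a else f u); split.
      by move=> u; rewrite inE; case: eqP => [->|_] //= /fN /(subsetP (NA _ _)).
    have avE u : u \in s -> arc a (f u) = arc v u.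
      by move=> /fN; rewrite inE => /andP[_ /eqP].
    have naf u : u \in s -> a != f u.
      move=> us'; apply/eqP => af; have /disjointFr/(_ aA) := dvA u us'.
      by rewrite af (subsetP (NA u a)) ?fN.
    move=> u w; rewrite !inE; case: eqP => [->|_] /=; case: eqP => [->|_] //=.
    + by rewrite !arc_irr.
    + by move=> _; exact: avE.
    + by move=> us' _; rewrite (arcC (naf u us')) (arcC (neq u us')) avE.
    + exact: fE.
  - move=> [u [w [X [Y [b [[us' ws uw] sX sY [cX cY] h]]]]]]; right.
    exists u, w, X, Y, b; split=> //.
    + by rewrite !inE us' ws !orbT.
    + exact: subset_trans sX (NA _ _).
    + exact: subset_trans sY (NA _ _).
    + by split; [apply: leq_trans cX _ | apply: leq_trans cY _];
        rewrite leq_mul2r leq_maxl orbT.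
have mAv : m <= D * #|A v| by apply: hA; rewrite inE eqxx.
right; pose X u := [set a in A v | L * #|N u a| <= #|A u|].
have [a aA||u us' cu] := @cover_pigeonhole _ _ s (A v) X.
- move/existsPn/(_ a): no; rewrite aA /= => /allPn[u us']; rewrite -leqNgt => h.
  by exists u => //; rewrite inE aA.
- by rewrite -cards_eq0 -lt0n; case: (#|A v|) mAv => //; rewrite muln0; lia.
exists v, u, (X u), (A u), (arc v u); split=> //.
- by rewrite !inE eqxx us' orbT; split=> //; exact: neq.
- by apply/subsetP => y; rewrite inE => /andP[].
- have := hA u; rewrite inE us' orbT => /(_ isT) mAu.
  split.
    apply: leq_trans mAv _; apply: leq_trans (_ : D * (size s * #|X u|) <= _).
      by rewrite leq_mul2l cu orbT.
    rewrite mulnA leq_mul2r; apply/orP; right.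
    by apply: leq_trans (leq_maxr _ _); rewrite leq_mul2l leqnSn orbT.
  apply: leq_trans mAu _; rewrite leq_mul2r; apply/orP; right.
  by apply: leq_trans (leq_maxr _ _); rewrite leq_pmulr.
- by move=> x; rewrite inE => /andP[].
Qed.

(** Markov's inequality: [r] has density at most [1/(2L)], so at most half of [Y] sees more than
    [1/L] of [X], and that part is dropped. The factor 2 is used again to pay for replacing [Y] by
    [Y'] in the bounds for [X]. *)
Lemma sparse_two_sided (T : finType) (L : nat) (r : rel T) (X Y : {set T}) : 0 < #|X| ->
  (forall x, x \in X -> 2 * L * #|[set y in Y | r x y]| <= #|Y|) ->
  exists Y' : {set T}, [/\ Y' \subset Y, #|Y| <= 2 * #|Y'|,
    forall x, x \in X -> L * #|[set y in Y' | r x y]| <= #|Y'| &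
    forall y, y \in Y' -> L * #|[set x in X | r x y]| <= #|X|].
Proof.
move=> X0 hX; pose Y' := [set y in Y | L * #|[set x in X | r x y]| <= #|X|].
have sY : Y' \subset Y by apply/subsetP => y; rewrite inE => /andP[].
have cY : #|Y| <= 2 * #|Y'|.
  have : 2 * (#|Y :\: Y'| * #|X|) <= #|X| * #|Y|.
    apply: leq_trans (_ : \sum_(x in X) 2 * L * #|[set y in Y | r x y]| <= _); last first.
      by rewrite -sum_nat_const leq_sum.
    rewrite -big_distrr /= double_count -mulnA leq_mul2l /=.
    rewrite (big_setID Y') /= mulnDr; apply: leq_trans (leq_addl _ _).
    rewrite -sum_nat_const big_distrr /= leq_sum // => y.
    by rewrite !inE => /andP[+ yY]; rewrite yY /= -ltnNge => /ltnW.
  rewrite mulnA mulnC leq_pmul2l // cardsD (setIidPr sY).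
  have := subset_leq_card sY; lia.
exists Y'; split=> // [x xX|y].
  have h : #|[set y in Y' | r x y]| <= #|[set y in Y | r x y]|.
    by apply/subset_leq_card/subsetP => y; rewrite !inE => /andP[/andP[-> _] ->].
  rewrite -(@leq_pmul2l 2) //; apply: leq_trans cY; apply: leq_trans (hX x xX).
  by rewrite mulnA leq_mul2l h orbT.
by rewrite inE => /andP[].
Qed.

Lemma sparse_pair (H : tournament) (L : nat) : exists C, forall T : tournament,
  ~ contains T H -> forall X : {set T}, C <= #|X| ->
  exists A B : {set T}, [/\ A \subset X, B \subset X,
    #|X| <= C * #|A|, #|X| <= C * #|B| & smooth L A B].
Proof.
pose h := #|H|; have [C hC] := @greedy_embedding H (2 * L) (enum H) 1 (enum_uniq H).
(* The first [2] absorbs the rounding in [m], [h.+1] the cutting into blocks (never zero), [C.+1]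
   the greedy embedding, the last [2] the passage from [Y1] to [Y']. *)
exists (2 * h.+1 * C.+1 * 2) => T noH X leX.
pose m := #|X| %/ h.+1.
have hm : h.+1 * m <= #|X| by rewrite mulnC leq_trunc_div.
have m0 : 0 < m by rewrite divn_gt0 //; nia.
have Xm : #|X| <= 2 * h.+1 * m.
  by have := ltn_ceil #|X| (ltn0Sn h); rewrite -/m; nia.
have [x0 _] : exists x, x \in X by apply/card_gt0P; nia.
have [|A [hA dA]] := @disjoint_family _ _ m (enum H) X.
  by rewrite -cardE; apply: leq_trans hm; rewrite leq_mul2r leqnSn orbT.
have [v vs|[f [_ fE]]|] := hC T x0 A m m0 _ dA.
- by have [_ ->] := hA v vs; rewrite mul1n.
- by case: noH; apply: (@contains_embedding _ _ f) => u v; apply: fE; rewrite mem_enum.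
move=> [u [v [X1 [Y1 [b [[us vs uv] sX sY [cX cY] hs]]]]]].
have X10 : 0 < #|X1| by case: (#|X1|) cX => //; rewrite muln0; lia.
have [Y' [sY' cY' hx hy]] := sparse_two_sided X10 hs.
have d : [disjoint X1 & Y'].
  by apply: disjointWl sX _; apply: disjointWr (subset_trans sY' sY) _; apply: dA.
have XX : X1 \subset X by apply: subset_trans sX _; case: (hA u us).
have YX : Y' \subset X by apply: subset_trans (subset_trans sY' sY) _; case: (hA v vs).
have neq x y : x \in X1 -> y \in Y' -> x != y.
  by move=> xX yY; apply: contraTneq yY => <-; rewrite (disjointFr d xX).
have eX : #|X| <= 2 * h.+1 * C.+1 * 2 * #|X1|.
  apply: leq_trans Xm _; rewrite -!mulnA leq_mul2l /=.
  by rewrite leq_mul2l /=; apply: leq_trans cX _; rewrite leq_mul ?leq_pmull.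
have eY : #|X| <= 2 * h.+1 * C.+1 * 2 * #|Y'|.
  apply: leq_trans Xm _; rewrite -!mulnA leq_mul2l /=.
  by rewrite leq_mul2l /=; apply: leq_trans cY _; apply: leq_mul.
(* The sparse direction [b] decides which of the two sets comes first. *)
case: b {hs} hx hy => hx hy; [exists Y', X1 | exists X1, Y']; split=> //; split=> //.
- by rewrite disjoint_sym.
- move=> y yY; apply: leq_trans (hy y yY); rewrite leq_mul2l; apply/orP; right.
  by apply/subset_leq_card/subsetP => x; rewrite !inE => /andP[-> ->].
- move=> x xX; apply: leq_trans (hx x xX); rewrite leq_mul2l; apply/orP; right.
  by apply/subset_leq_card/subsetP => y; rewrite !inE => /andP[-> ->].
- move=> x xX; apply: leq_trans (hx x xX); rewrite leq_mul2l; apply/orP; right.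
  apply/subset_leq_card/subsetP => y; rewrite !inE => /andP[yY yx].
  by rewrite yY -[arc x y]negbK -(arcC (neq x y xX yY)) yx.
- move=> y yY; apply: leq_trans (hy y yY); rewrite leq_mul2l; apply/orP; right.
  apply/subset_leq_card/subsetP => x; rewrite !inE => /andP[xX yx].
  by rewrite xX -[arc x y]negbK -(arcC (neq x y xX yY)) yx.
Qed.

(** A smooth pair is taken and the construction goes on inside its second set. The surplus factor
    [D.+1] in its smoothness is what passing to the later, smaller sets costs. *)
Lemma smooth_chain (H : tournament) (L k : nat) : exists C, forall T : tournament,
  ~ contains T H -> forall X : {set T}, C <= #|X| ->
  exists A : nat -> {set T},
    (forall i, i < k -> A i \subset X /\ #|X| <= C * #|A i|) /\
    (forall i j, i < j -> j < k -> smooth L (A i) (A j)).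
Proof.
elim: k => [|k [D IH]]; first by exists 0 => T _ X _; exists (fun _ => set0).
have [C hC] := sparse_pair H (L * D.+1).
exists (C.+1 * D.+1) => T noH X leX.
have [|A0 [B [sA sB cA cB sm]]] := hC T noH X; first by nia.
have [|A [hA sA']] := IH T noH B; first by nia.
exists (fun i => if i is j.+1 then A j else A0); split.
  case=> [_|i]; first by split=> //; nia.
  rewrite ltnS => /hA[s c]; split; first exact: subset_trans s sB.
  by nia.
case=> [|i] [|j] //.
  rewrite ltnS => _ /hA[s c]; apply: (smooth_sub (ltn0Sn D) sm) => //; nia.
by rewrite !ltnS; exact: sA'.
Qed.

(** * Homogeneous pairs from coinciding neighbourhoods *)

(** Take [J] of maximal size whose preimage fills at most half of [P]. If that preimage fills a
    quarter, [J] and its complement work; otherwise adding any further value crosses one half, so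
    the fibre of this value exceeds a quarter. *)
Lemma fibre_split (T I : finType) (g : T -> I) (P : {set T}) : 0 < #|P| ->
  (exists i, #|P| <= 4 * #|[set x in P | g x == i]|) \/
  exists J : {set I}, #|P| <= 4 * #|[set x in P | g x \in J]| /\
                      #|P| <= 4 * #|[set x in P | g x \notin J]|.
Proof.
move=> P0; pose F (J : {set I}) := [set x in P | g x \in J].
have F0 : 2 * #|F set0| <= #|P|.
  by rewrite (_ : F set0 = set0) ?cards0 //; apply/setP => x; rewrite !inE andbF.
case: (@arg_maxnP _ set0 (fun J => 2 * #|F J| <= #|P|) (fun J => #|J|) F0) => J leJ maxJ.
have Fsplit : #|F J| + #|[set x in P | g x \notin J]| = #|P|.
  rewrite -(cardsID (F J) P); congr (_ + _); apply: eq_card => x; rewrite !inE;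
  by case: (x \in P) => //; rewrite andbT.
have [small|big] := ltnP (4 * #|F J|) #|P|; last by right; exists J; split=> //; lia.
left; have [/existsP[i iJ]|allJ] := boolP [exists i, i \notin J]; last first.
  have FP : F J = P.
    apply/setP => x; rewrite !inE; case: (x \in P) => //=.
    by move/existsPn/(_ (g x)): allJ; rewrite negbK => ->.
  by move: leJ; rewrite FP; lia.
exists i; have Fi : #|F (i |: J)| <= #|[set x in P | g x == i]| + #|F J|.
  apply: leq_trans (leq_card_setU _ _); apply/subset_leq_card/subsetP => x.
  by rewrite !inE => /andP[-> /orP[->|->]]; rewrite ?orbT.
have : ~~ (2 * #|F (i |: J)| <= #|P|).
  by apply/negP => /maxJ; rewrite cardsU1 iJ /=; lia.
rewrite -ltnNge; lia.
Qed.

Definition homogeneous_pair (T : finType) (r : rel T) (P Q : {set T}) : Prop :=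
  exists (P' Q' : {set T}) (b : bool), [/\ P' \subset P, Q' \subset Q,
    #|P| <= 4 * #|P'|, #|Q| <= 4 * #|Q'| & {in P' & Q', forall x y, r x y = b}].

Lemma homogeneous_pair_flip (T : finType) (r : rel T) (P Q : {set T}) :
  homogeneous_pair r P Q -> homogeneous_pair (fun x y => r y x) Q P.
Proof. by case=> [P' [Q' [b [? ? ? ? h]]]]; exists Q', P', b; split=> // x y ? ?; apply: h. Qed.

Lemma half_card (T : finType) (S W : {set T}) :
  #|S| <= 2 * #|S :&: W| \/ #|S| <= 2 * #|S :\: W|.
Proof.
have := cardsID W S; have [?|?] := leqP (#|S :\: W|) #|S :&: W|; [left|right]; lia.
Qed.

(** Related vertices have equal neighbourhoods in [S]. If a quarter of [P] shares a neighbourhood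
    [W], a half of [S] inside or outside [W] completes a homogeneous pair for [p]. Otherwise
    [fibre_split] cuts the neighbourhoods into two classes, and [r] vanishes between vertices of
    opposite classes. *)
Lemma twins_homogeneous (T : finType) (r p q : rel T) (P Q S : {set T}) : 0 < #|P| ->
  {in P & Q, forall x y, r x y -> {in S, forall s, p x s = q y s}} ->
  homogeneous_pair r P Q \/ homogeneous_pair p P S.
Proof.
move=> P0 twin; pose N x := [set s in S | p x s]; pose M y := [set s in S | q y s].
have NM x y : x \in P -> y \in Q -> r x y -> N x = M y.
  move=> xP yQ rxy; apply/setP => s; rewrite !inE; case: (boolP (s \in S)) => //=.
  exact: twin rxy s.
have sub (U : {set T}) (c : pred T) : [set x in U | c x] \subset U.
  by apply/subsetP => x; rewrite inE => /andP[].
have [[W hW]|[J [hJ hJc]]] := fibre_split N P0.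
  right; have [hS|hS] := half_card S W.
    exists [set x in P | N x == W], (S :&: W), true; split; rewrite ?subsetIl ?sub //; first lia.
    move=> x s; rewrite !inE => /andP[_ /eqP xW] /andP[sS]; rewrite -xW inE => /andP[_ //].
  exists [set x in P | N x == W], (S :\: W), false; split; rewrite ?subsetDl ?sub //; first lia.
  move=> x s; rewrite !inE => /andP[_ /eqP xW] /andP[]; rewrite -xW inE => + sS.
  by rewrite sS /= => /negbTE.
(* The class that takes half of [Q] is matched with the opposite class in [P]. *)
left; have [hQ|hQ] := half_card Q [set y | M y \notin J].
  exists [set x in P | N x \in J], (Q :&: [set y | M y \notin J]), false.
  split; rewrite ?subsetIl ?sub //; first lia.
  move=> x y; rewrite !inE => /andP[xP xJ] /andP[yQ yJ]; apply/negP => /(NM x y xP yQ) e.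
  by rewrite e (negbTE yJ) in xJ.
exists [set x in P | N x \notin J], (Q :\: [set y | M y \notin J]), false.
split; rewrite ?subsetDl ?sub //; first lia.
move=> x y; rewrite !inE negbK => /andP[xP xJ] /andP[yJ yQ]; apply/negP => /(NM x y xP yQ) e.
by rewrite e yJ in xJ.
Qed.

(** * Pure pairs and star patterns on triples *)

Definition pure_pair (T : tournament) (K : nat) (Y : {set T}) : Prop :=
  exists A B : {set T}, [/\ A \subset Y, B \subset Y, #|Y| <= K * #|A|, #|Y| <= K * #|B| &
    {in A & B, forall a b, arc a b}].

Lemma homogeneous_pure (T : tournament) (K : nat) (Y A B : {set T}) :
  [disjoint A & B] -> A \subset Y -> B \subset Y ->
  #|Y| <= K * #|A| -> #|Y| <= K * #|B| -> homogeneous_pair arc A B ->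
  pure_pair (4 * K) Y.
Proof.
move=> dAB sA sB cA cB [A' [B' [b [sA' sB' cA' cB' hb]]]].
have neq x y : x \in A' -> y \in B' -> x != y.
  move=> /(subsetP sA') xA /(subsetP sB') yB.
  by apply: contraTneq yB => <-; rewrite (disjointFr dAB xA).
have eA : #|Y| <= 4 * K * #|A'| by nia.
have eB : #|Y| <= 4 * K * #|B'| by nia.
have sAY := subset_trans sA' sA; have sBY := subset_trans sB' sB.
case: b hb => hb; [exists A', B' | exists B', A']; split=> //.
by move=> y x yB xA; rewrite (arcC (neq x y xA yB)) hb.
Qed.

(* (e12, e13, e23) records which pairs of a triple x < y < z are backward. *)
Definition pattern : finType := (bool * bool * bool)%type.
Definition left_pattern : pattern := (true, true, false).
Definition right_pattern : pattern := (false, true, true).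
Definition central_pattern : pattern := (true, false, true).

Definition has_pattern (T : tournament) (e : pattern) (x y z : T) : bool :=
  [&& arc y x == e.1.1, arc z x == e.1.2 & arc z y == e.2].

Definition pattern_free (T : tournament) (e : pattern) (X Y Z : {set T}) : bool :=
  [forall x in X, forall y in Y, forall z in Z, ~~ has_pattern e x y z].

Lemma pattern_freeP (T : tournament) (e : pattern) (X Y Z : {set T}) :
  reflect (forall x y z, x \in X -> y \in Y -> z \in Z -> ~~ has_pattern e x y z)
          (pattern_free e X Y Z).
Proof.
apply: (iffP forall_inP) => [h x y z xX yY zZ|h x xX].
  by move/forall_inP/(_ y yY)/forall_inP/(_ z zZ): (h x xX).
by apply/forall_inP => y yY; apply/forall_inP => z zZ; exact: h.
Qed.

Lemma pattern_free_sub (T : tournament) e (X Y Z X' Y' Z' : {set T}) :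
  X' \subset X -> Y' \subset Y -> Z' \subset Z ->
  pattern_free e X Y Z -> pattern_free e X' Y' Z'.
Proof.
move=> sX sY sZ /pattern_freeP h; apply/pattern_freeP => x y z xX yY zZ.
by apply: h; [exact: (subsetP sX) | exact: (subsetP sY) | exact: (subsetP sZ)].
Qed.

(** The factor [2] matches [available_half]: the candidates left for a vertex always fill half of
    its block. *)
Definition pattern_rich (T : tournament) (e : pattern) (X Y Z : {set T}) : Prop :=
  forall X' Y' Z' : {set T}, X' \subset X -> Y' \subset Y -> Z' \subset Z ->
  #|X| <= 2 * #|X'| -> #|Y| <= 2 * #|Y'| -> #|Z| <= 2 * #|Z'| ->
  ~~ pattern_free e X' Y' Z'.

Definition compatible (e1 e2 : pattern) : bool :=
  (e1, e2) \in [:: (left_pattern, right_pattern); (left_pattern, central_pattern);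
                   (right_pattern, central_pattern)].

(** Two star patterns share one backward pair and differ in which end of it has a backward edge to
    the third vertex. With both excluded, the ends of a backward edge in the shared position have
    the same backward neighbours in the third set, so [twins_homogeneous] applies. *)
Lemma two_free_pure (T : tournament) (K : nat) (e1 e2 : pattern) (V X Y Z : {set T}) :
  compatible e1 e2 -> 0 < #|V| ->
  [/\ [disjoint X & Y], [disjoint X & Z] & [disjoint Y & Z]] ->
  [/\ X \subset V, Y \subset V & Z \subset V] ->
  [/\ #|V| <= K * #|X|, #|V| <= K * #|Y| & #|V| <= K * #|Z|] ->
  pattern_free e1 X Y Z -> pattern_free e2 X Y Z -> pure_pair (4 * K) V.
Proof.
move=> e12 V0 [dXY dXZ dYZ] [sX sY sZ] [cX cY cZ] /pattern_freeP h1 /pattern_freeP h2.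
have X0 : 0 < #|X| by case: (#|X|) cX => //; rewrite muln0; lia.
have Y0 : 0 < #|Y| by case: (#|Y|) cY => //; rewrite muln0; lia.
pose back := fun x y : T => arc y x.
have pure (A B : {set T}) : [disjoint A & B] -> A \subset V -> B \subset V -> #|V| <= K * #|A| ->
    #|V| <= K * #|B| -> homogeneous_pair back A B -> pure_pair (4 * K) V.
  move=> d sA sB cA cB /homogeneous_pair_flip.
  by apply: homogeneous_pure => //; rewrite disjoint_sym.
move: e12; rewrite /compatible !inE => /or3P[] /eqP[e1E e2E]; rewrite {}e1E {}e2E in h1 h2.
(* The shared pairs are [x, z], then [x, y], then [y, z]. Backward neighbours are expressed by
   [back] or [arc] according as the third set lies after or before. *)
- have [x z xX zZ rxz y yY||] := @twins_homogeneous T back back arc X Z Y X0.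
  + have := h1 x y z xX yY zZ; have := h2 x y z xX yY zZ.
    move: rxz; rewrite /has_pattern /back /= => ->; rewrite !eqb_id !eqbF_neg.
    by case: (arc y x); case: (arc z y).
  + by move=> h; apply: pure h.
  + by move=> h; apply: pure h.
- have [x y xX yY rxy z zZ||] := @twins_homogeneous T back back back X Y Z X0.
  + have := h1 x y z xX yY zZ; have := h2 x y z xX yY zZ.
    by rewrite /has_pattern /= (rxy : arc y x) /back; case: (arc z x); case: (arc z y).
  + by move=> h; apply: pure h.
  + by move=> h; apply: pure h.
- have [y z yY zZ ryz x xX||] := @twins_homogeneous T back arc arc Y Z X Y0.
  + have := h1 x y z xX yY zZ; have := h2 x y z xX yY zZ.
    move: ryz; rewrite /has_pattern /back /= => ->; rewrite !eqb_id !eqbF_neg.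
    by case: (arc y x); case: (arc z x).
  + by move=> h; apply: pure h.
  + by apply: homogeneous_pure => //; rewrite disjoint_sym.
Qed.

(** * Making every triple free of or rich in each pattern *)

(** While some triple is neither free of [e] nor rich in it, its blocks are replaced by parts at
    least half as large that are free of [e]. Freeness survives shrinking, so the set [F] grows each
    time, and the number of halvings is at most the number of pairs of a pattern and a triple. *)
Lemma stable_subfamily (T : tournament) (N : nat) (A : 'I_N -> {set T}) :
  exists A' : 'I_N -> {set T},
    (forall i, A' i \subset A i /\
               #|A i| <= 2 ^ #|{: pattern * ('I_N * 'I_N * 'I_N)}| * #|A' i|) /\
    forall e (i j k : 'I_N), i < j < k ->
      pattern_free e (A' i) (A' j) (A' k) \/ pattern_rich e (A' i) (A' j) (A' k).
Proof.
pose U := (pattern * ('I_N * 'I_N * 'I_N))%type.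
pose F (B : 'I_N -> {set T}) :=
  [set t : U | pattern_free t.1 (B t.2.1.1) (B t.2.1.2) (B t.2.2)].
suff main m : forall B : 'I_N -> {set T}, #|~: F B| <= m -> exists A' : 'I_N -> {set T},
    (forall i, A' i \subset B i /\ #|B i| <= 2 ^ m * #|A' i|) /\
    forall e (i j k : 'I_N), i < j < k ->
      pattern_free e (A' i) (A' j) (A' k) \/ pattern_rich e (A' i) (A' j) (A' k).
  by apply: main; exact: max_card.
elim: m => [|m IH] B hm.
  exists B; split=> [i|e i j k _]; first by rewrite mul1n.
  left; move: hm; rewrite leqn0 cards_eq0 => /eqP/setP/(_ (e, (i, j, k))).
  by rewrite !inE /= => /negbFE.
pose weak (t : U) (X Y Z : {set T}) := [&& X \subset B t.2.1.1, Y \subset B t.2.1.2,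
  Z \subset B t.2.2, #|B t.2.1.1| <= 2 * #|X|, #|B t.2.1.2| <= 2 * #|Y| &
  (#|B t.2.2| <= 2 * #|Z|) && pattern_free t.1 X Y Z].
have [/existsP[[e [[i j] k]] /and3P[ijk nfree /existsP[X /existsP[Y /existsP[Z]]]]]|no] :=
  boolP [exists t : U, [&& t.2.1.1 < t.2.1.2 < t.2.2, t \notin F B &
           [exists X, exists Y, exists Z, weak t X Y Z]]]; last first.
  exists B; split=> [i|e i j k ijk]; first by rewrite leq_pmull // expn_gt0.
  have [f|nf] := boolP (pattern_free e (B i) (B j) (B k)); [by left | right].
  move=> X Y Z sX sY sZ cX cY cZ; apply/negP => free.
  move/existsPn/(_ (e, (i, j, k))): no; rewrite /= ijk inE nf /=.
  case/existsP; exists X; apply/existsP; exists Y; apply/existsP; exists Z.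
  by rewrite /weak /= sX sY sZ cX cY cZ.
case/and5P => /= sX sY sZ cX /and3P[cY cZ free]; rewrite /= in ijk.
have [ij jk] := andP ijk.
pose B' l := if l == i then X else if l == j then Y else if l == k then Z else B l.
have ji : (j == i) = false by apply/eqP => e'; move: ij; rewrite e' ltnn.
have kj : (k == j) = false by apply/eqP => e'; move: jk; rewrite e' ltnn.
have ki : (k == i) = false by apply/eqP => e'; move: (ltn_trans ij jk); rewrite e' ltnn.
have hB' l : B' l \subset B l /\ #|B l| <= 2 * #|B' l|.
  rewrite /B'; case: eqP => [->//|_]; case: eqP => [->//|_]; case: eqP => [->//|_].
  by split=> //; lia.
have [|A' [hA' st]] := IH B'.
  rewrite -ltnS; apply: leq_trans hm; apply/proper_card/properP; split.
    apply/subsetP => t; rewrite !inE; apply: contra.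
    by apply: pattern_free_sub; case: (hB' t.2.1.1); case: (hB' t.2.1.2); case: (hB' t.2.2).
  exists (e, (i, j, k)); first by rewrite inE.
  by rewrite !inE /= /B' eqxx ji eqxx ki kj eqxx negbK.
exists A'; split=> // l; have [s c] := hA' l; have [s' c'] := hB' l.
split; first exact: subset_trans s s'.
by rewrite expnS -mulnA; apply: leq_trans c' _; rewrite leq_mul2l c.
Qed.

(** * Components of the backward graph and nebulas in terms of patterns *)

Definition component (T : tournament) (theta : seq T) (v : T) : {set T} :=
  [set u | connect (backward_graph theta) v u].

(** Listing the star in increasing order, instead of from its center, treats the three kinds
    uniformly. *)
Definition pattern_component (e : pattern) (T : tournament) (theta : seq T) (C : {set T}) :=
  exists x y z, [/\ C = [set x; y; z], precedes theta x y, precedes theta y z &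
                    has_pattern e x y z].

Definition pattern_nebula (e : pattern) (H : tournament) : Prop :=
  exists theta : seq H, is_ordering theta /\
    forall v, component theta v = [set v] \/ pattern_component e theta (component theta v).

Section Orderings.

Variables (T : tournament) (theta : seq T).
Hypothesis ord : is_ordering theta.

Lemma precedes_total (u v : T) : u != v -> precedes theta u v || precedes theta v u.
Proof.
have [_ mem] := ord; rewrite /precedes; case: ltngtP => // e /eqP[].
by rewrite -(nth_index u (mem u)) e nth_index.
Qed.

Lemma precedes_asym (u v : T) : precedes theta u v -> precedes theta v u = false.
Proof. by rewrite /precedes; lia. Qed.

Lemma backward_graphE (u v : T) : precedes theta u v -> backward_graph theta u v = arc v u.
Proof.
by move=> uv; rewrite /backward_graph /backward_edge uv precedes_asym // andbF andbT.
Qed.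

Lemma backward_graph_sym : symmetric (backward_graph theta).
Proof. by move=> u v; rewrite /backward_graph orbC. Qed.

Lemma connect_backward_sym : connect_sym (backward_graph theta).
Proof. exact: sym_connect_sym backward_graph_sym. Qed.

Lemma component_refl (v : T) : v \in component theta v.
Proof. by rewrite inE connect0. Qed.

Lemma component_eq (u v : T) : u \in component theta v -> component theta u = component theta v.
Proof.
rewrite inE => vu; apply/setP => w; rewrite !inE.
by rewrite (same_connect connect_backward_sym vu).
Qed.

(** An arc against the order would be an edge of the backward graph and would put [u] and [w] in one
    component. *)
Lemma arc_across (u w : T) : u \notin component theta w -> arc u w = precedes theta u w.
Proof.
move=> uw; have neq : u != w by apply: contraNneq uw => ->; exact: component_refl.
have nbg : ~~ backward_graph theta w u by apply: contra uw => h; rewrite inE connect1.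
have /orP[p|p] := precedes_total neq.
  by rewrite p (arcC (_ : w != u)) 1?eq_sym // -(backward_graphE p) backward_graph_sym.
by rewrite precedes_asym // -(backward_graphE p); apply/negbTE.
Qed.

Lemma left_star_pattern (C : {set T}) :
  left_star theta C -> pattern_component left_pattern theta C.
Proof.
move=> [c [a [b [[-> + ca cb nab] pa pb]]]]; rewrite /= !inE => /and3P[_ ab _].
rewrite (backward_graphE pa) in ca; rewrite (backward_graphE pb) in cb.
(* The leaves of [star3] come in no particular order, whereas a pattern needs them sorted. *)
have /orP[p|p] := precedes_total ab.
  exists c, a, b; split=> //; rewrite (backward_graphE p) in nab.
  by rewrite /has_pattern /= ca cb (negbTE nab).
exists c, b, a; split=> //.
  by apply/setP => x; rewrite !inE -!orbA [(x == a) || _]orbC.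
rewrite backward_graph_sym (backward_graphE p) in nab.
by rewrite /has_pattern /= ca cb (negbTE nab).
Qed.

Lemma right_star_pattern (C : {set T}) :
  right_star theta C -> pattern_component right_pattern theta C.
Proof.
move=> [c [a [b [[-> + ca cb nab] pa pb]]]]; rewrite /= !inE => /and3P[_ ab _].
rewrite backward_graph_sym (backward_graphE pa) in ca.
rewrite backward_graph_sym (backward_graphE pb) in cb.
have /orP[p|p] := precedes_total ab.
  exists a, b, c; split=> //.
    by apply/setP => x; rewrite !inE -!orbA orbC -orbA.
  rewrite (backward_graphE p) in nab.
  by rewrite /has_pattern /= ca cb (negbTE nab).
exists b, a, c; split=> //.
  by apply/setP => x; rewrite !inE -!orbA orbC -orbA orbCA.
rewrite backward_graph_sym (backward_graphE p) in nab.
by rewrite /has_pattern /= ca cb (negbTE nab).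
Qed.

Lemma central_star_pattern (C : {set T}) :
  central_star theta C -> pattern_component central_pattern theta C.
Proof.
move=> [c [a [b [[-> _ ca cb nab] pa pb]]]].
rewrite backward_graph_sym (backward_graphE pa) in ca.
rewrite (backward_graphE pb) in cb.
have p : precedes theta a b by move: pa pb; rewrite /precedes; lia.
rewrite (backward_graphE p) in nab.
exists a, c, b; split=> //; last by rewrite /has_pattern /= ca cb (negbTE nab).
by apply/setP => x; rewrite !inE -!orbA orbCA.
Qed.

End Orderings.

Lemma nebula_pattern (star : forall T : tournament, seq T -> {set T} -> Prop) e (H : tournament) :
  (forall (T : tournament) (theta : seq T), is_ordering theta ->
     forall C, star T theta C -> pattern_component e theta C) ->
  nebula star H -> pattern_nebula e H.
Proof.
move=> starP [theta [ord hC]]; exists theta; split=> // v.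
have isc : is_component theta (component theta v) by exists v.
have [st|[w vw]] := hC _ isc; first by right; exact: starP ord _ st.
left; by have := component_refl theta v; rewrite vw inE => /eqP ->.
Qed.

(** * Embedding a nebula one component at a time *)

Section NebulaEmbedding.

Variables (e : pattern) (H T : tournament) (theta : seq H) (B : H -> {set T}) (L : nat).
Hypothesis ord : is_ordering theta.
Hypothesis comp : forall v,
  component theta v = [set v] \/ pattern_component e theta (component theta v).
Hypothesis B0 : forall v, B v != set0.
Hypothesis leL : 2 * #|H| <= L.
Hypothesis smoothB : forall u v, precedes theta u v -> smooth L (B u) (B v).
Hypothesis richB : forall x y z, precedes theta x y -> precedes theta y z ->
  pattern_rich e (B x) (B y) (B z).

Definition partial_embedding (S : {set H}) (f : H -> T) : Prop :=
  {in S, forall v, f v \in B v} /\ {in S &, forall u v, arc (f u) (f v) = arc u v}.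

(** The order [theta], not [arc] of [H], prescribes the adjacencies: whole components are embedded,
    so by [arc_across] all arcs between [S] and a new [v] go forward. *)
Definition available (S : {set H}) (f : H -> T) (v : H) : {set T} :=
  [set x in B v | [forall u in S, arc (f u) x == precedes theta u v]].

Lemma blocks_disjoint (u v : H) a b : u != v -> a \in B u -> b \in B v -> a != b.
Proof.
move=> uv aB bB; apply: contraTneq aB => ->.
have /orP[p|p] := precedes_total ord uv; have [d _ _] := smoothB p.
  by rewrite (disjointFl d bB).
by rewrite (disjointFr d bB).
Qed.

(** Each embedded vertex spoils at most a fraction [1/L] of [B v], and there are at most [#|H|] of
    them, with [2 * #|H| <= L]. *)
Lemma available_half (S : {set H}) f v : partial_embedding S f -> v \notin S ->
  #|B v| <= 2 * #|available S f v|.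
Proof.
move=> [fB _] vS; pose bad u := [set x in B v | arc (f u) x != precedes theta u v].
have bad_small u : u \in S -> L * #|bad u| <= #|B v|.
  move=> uS; have uv : u != v by apply: contraNneq vS => <-.
  have /orP[p|p] := precedes_total ord uv; have [_ h1 h2] := smoothB p.
    apply: leq_trans (h1 _ (fB u uS)); rewrite leq_mul2l; apply/orP; right.
    apply/subset_leq_card/subsetP => x; rewrite !inE p => /andP[xB].
    rewrite xB (arcC (blocks_disjoint uv (fB u uS) xB)); by case: (arc _ _).
  apply: leq_trans (h2 _ (fB u uS)); rewrite leq_mul2l; apply/orP; right.
  apply/subset_leq_card/subsetP => x; rewrite !inE (precedes_asym p) => /andP[-> /=].
  by case: (arc _ _).
have sA : available S f v \subset B v by apply/subsetP => x; rewrite inE => /andP[].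
have := cardsD (B v) (available S f v); rewrite (setIidPr sA).
have := subset_leq_card sA.
have [->|D0] := eqVneq (B v :\: available S f v) set0; first by rewrite cards0; lia.
have [|u] := @cover_pigeonhole _ _ (enum S) _ bad _ D0.
  move=> x; rewrite !inE => /andP[+ xB]; rewrite xB /= negb_forall_in.
  by case/exists_inP => u uS h; exists u; rewrite ?mem_enum // inE xB.
rewrite mem_enum -cardE => /bad_small.
have : 2 * (#|S| * #|bad u|) <= L * #|bad u|.
  by rewrite mulnA leq_mul2r (leq_trans _ leL) ?orbT // leq_mul2l max_card.
lia.
Qed.

Lemma partial_embedding_extend (S : {set H}) f v g : partial_embedding S f ->
  [disjoint S & component theta v] ->
  {in component theta v, forall w, g w \in available S f w} ->
  {in component theta v &, forall u w, arc (g u) (g w) = arc u w} ->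
  partial_embedding (S :|: component theta v)
    (fun u => if u \in component theta v then g u else f u).
Proof.
set C := component theta v => -[fB fE] dSC gA gE.
have gB w : w \in C -> g w \in B w by move=> /gA; rewrite inE => /andP[].
split.
  move=> w; rewrite inE; case: ifP => [wC _|_]; first exact: gB.
  by rewrite orbF; exact: fB.
have cross u w : u \in S -> w \in C -> arc (f u) (g w) = arc u w /\ arc (g w) (f u) = arc w u.
  move=> uS wC; have uC : u \notin C by rewrite (disjointFr dSC uS).
  have uw : u != w by apply: contraNneq uC => ->.
  have E : arc (f u) (g w) = arc u w.
    rewrite (arc_across ord) ?(component_eq wC) //.
    by have := gA w wC; rewrite inE => /andP[_ /forall_inP/(_ u uS)/eqP].
  split=> //; rewrite (arcC uw) (arcC (_ : f u != g w)) ?E //.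
  by apply: blocks_disjoint uw _ _; [exact: fB | exact: gB].
move=> u w; rewrite !in_setU; case: ifP => uC; case: ifP => wC; rewrite ?orbT ?orbF /=.
- by move=> _ _; exact: gE.
- by move=> _ wS; case: (cross w u wS uC).
- by move=> uS _; case: (cross u w uS wC).
- exact: fE.
Qed.

(** Induction over unions [S] of components: one component is removed, the rest is embedded, and the
    component is placed in the available sets. *)
Lemma nebula_partial_embedding n (S : {set H}) : #|S| <= n ->
  {in S, forall v, component theta v \subset S} -> exists f, partial_embedding S f.
Proof.
elim: n S => [|n IH] S.
  rewrite leqn0 cards_eq0 => /eqP -> _.
  have nonempty v : exists x, x \in B v by apply/set0Pn.
  by exists (fun v => xchoose (nonempty v)); split=> [v|u v]; rewrite inE.
move=> leS closedS; have [S0|[v vS]] := set_0Vmem S.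
  by apply: IH; rewrite ?S0 ?cards0 // => v; rewrite inE.
pose C := component theta v; have sC : C \subset S by exact: closedS.
have [|u|f fP] := IH (S :\: C).
- rewrite -ltnS; apply: leq_trans leS; apply/proper_card/properP; split; first exact: subsetDl.
  by exists v; rewrite // inE component_refl.
- rewrite inE => /andP[uC uS]; apply/subsetP => w wu.
  rewrite inE (subsetP (closedS u uS)) // andbT; apply: contra uC => wC.
  by rewrite /C -(component_eq wC) (component_eq wu) component_refl.
have dC : [disjoint S :\: C & C].
  by rewrite disjoint_sym disjoints_subset; apply/subsetP => w wC; rewrite in_setC in_setD wC.
have SE : S = S :\: C :|: C.
  apply/setP => w; rewrite in_setU in_setD; have [/(subsetP sC) ->|] := boolP (w \in C).
    by rewrite orbT.
  by rewrite orbF.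
have half w : w \in C -> #|B w| <= 2 * #|available (S :\: C) f w|.
  by move=> wC; apply: available_half; rewrite // inE wC.
have sub w : available (S :\: C) f w \subset B w.
  by apply/subsetP => x; rewrite inE => /andP[].
suff [g [gA gE]] : exists g : H -> T, {in C, forall w, g w \in available (S :\: C) f w} /\
    {in C &, forall u w, arc (g u) (g w) = arc u w}.
  by eexists; rewrite {1}SE; exact: partial_embedding_extend gA gE.
case: (comp v) => [Cv|[x [y [z [CE xy yz xyz]]]]].
  have [a aA] : exists a, a \in available (S :\: C) f v.
    apply/set0Pn; rewrite -cards_eq0 -lt0n.
    have := half v (component_refl _ _); have := B0 v; rewrite -cards_eq0; lia.
  have inC w : w \in C -> w = v by rewrite /C Cv => /set1P.
  by exists (fun _ => a); split=> [w /inC->|u w /inC-> /inC->] //; rewrite !arc_irr.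
rewrite -/C in CE.
have [xC yC zC] : [/\ x \in C, y \in C & z \in C].
  by rewrite CE !inE !eqxx !orbT.
(* The available sets fill half of their blocks, so richness supplies a copy of the star inside
   them. *)
have := richB xy yz (sub x) (sub y) (sub z) (half x xC) (half y yC) (half z zC).
rewrite negb_forall_in => /exists_inP[a aA]; rewrite negb_forall_in => /exists_inP[b bA].
rewrite negb_forall_in => /exists_inP[c cA]; rewrite negbK => abc.
have neq u w : precedes theta u w -> u != w.
  by move=> uw; apply/eqP => E; move: uw; rewrite E /precedes ltnn.
have xz : precedes theta x z := ltn_trans xy yz.
have [nxy nyz nxz] := And3 (neq _ _ xy) (neq _ _ yz) (neq _ _ xz).
have aB := subsetP (sub x) a aA; have bB := subsetP (sub y) b bA.
have cB := subsetP (sub z) c cA.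
have nab := blocks_disjoint nxy aB bB; have nbc := blocks_disjoint nyz bB cB.
have nac := blocks_disjoint nxz aB cB.
case/and3P: abc => /eqP e1 /eqP e2 /eqP e3; case/and3P: xyz => /eqP d1 /eqP d2 /eqP d3.
exists (fun w => if w == x then a else if w == y then b else c).
have [yx zx zy] : [/\ (y == x) = false, (z == x) = false & (z == y) = false].
  by rewrite ![y == _]eq_sym ![z == _]eq_sym (negbTE nxy) (negbTE nxz) (negbTE nyz).
have inC w : w \in C -> [|| w == x, w == y | w == z] by rewrite CE !inE -!orbA.
split=> [w /inC|u w /inC + /inC].
  by move=> /or3P[] /eqP->; rewrite ?eqxx ?yx ?zx ?zy.
have [ba ca cb] := And3 (arcC nab) (arcC nac) (arcC nbc).
have [YX ZX ZY] := And3 (arcC nxy) (arcC nxz) (arcC nyz).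
move=> /or3P[] /eqP-> /or3P[] /eqP->; rewrite ?eqxx ?yx ?zx ?zy ?eqxx ?arc_irr //.
- by apply: negb_inj; rewrite -ba -YX e1.
- by apply: negb_inj; rewrite -ca -ZX e2.
- by rewrite e1.
- by apply: negb_inj; rewrite -cb -ZY e3.
- by rewrite e2.
- by rewrite e3.
Qed.

Lemma nebula_embedding : contains T H.
Proof.
have [|v _|f [_ fE]] := @nebula_partial_embedding #|H| [set: H].
- by rewrite cardsT.
- exact: subsetT.
- by apply: (@contains_embedding _ _ f) => u v; apply: fE; rewrite inE.
Qed.

End NebulaEmbedding.

(** * Linear pure pairs in tournaments avoiding two nebulas *)

Lemma subseq_nth3 (I : eqType) (i0 : I) (s : seq I) i j k :
  i < j -> j < k -> k < size s -> subseq [:: nth i0 s i; nth i0 s j; nth i0 s k] s.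
Proof.
move=> ij jk ks; rewrite -[X in subseq _ X](cat_take_drop j).
rewrite -(cat1s (nth i0 s i)); apply: cat_subseq.
  rewrite sub1seq -(nth_take i0 ij) mem_nth // size_take; case: ifP; lia.
rewrite (drop_nth i0) /= ?eqxx ?sub1seq; last by lia.
have -> : nth i0 s k = nth i0 (drop j.+1 s) (k - j.+1) by rewrite nth_drop subnKC.
by rewrite mem_nth // size_drop; lia.
Qed.

Lemma enum_ord_increasing N : pairwise (fun i j : 'I_N => i < j) (enum 'I_N).
Proof.
have := iota_ltn_sorted 0 N; rewrite (sorted_pairwise ltn_trans) -val_enum_ord.
by rewrite pairwise_map.
Qed.

Lemma homogeneous_embedding (e : pattern) (H T : tournament) (N L : nat)
    (A : 'I_N -> {set T}) (s : seq 'I_N) :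
  pattern_nebula e H -> 2 * #|H| <= L -> (forall i, A i != set0) ->
  (forall i j : 'I_N, i < j -> smooth L (A i) (A j)) ->
  subseq s (enum 'I_N) -> #|H| < size s ->
  (forall i j k : 'I_N, subseq [:: i; j; k] s -> pattern_rich e (A i) (A j) (A k)) ->
  contains T H.
Proof.
move=> [theta [ord comp]] leL A0 smA sub_s lt_s rich.
(* The bound on [size s] is strict, so a default index [i0] exists even if [H] is empty. *)
have [i0 _] : exists i, i \in s by case: (s) lt_s => // i ? _; exists i; rewrite inE eqxx.
have index_lt v : index v theta < size s.
  have [uth mth] := ord; apply: leq_trans lt_s.
  apply: ltnW; rewrite ltnS; apply: leq_trans (_ : size theta <= _).
    by rewrite index_mem.
  by rewrite -(card_uniqP uth) max_card.
have ps : pairwise (fun i j : 'I_N => i < j) s.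
  exact: subseq_pairwise sub_s (enum_ord_increasing N).
(* The vertex at a given position of [theta] receives the block at the same position of [s]. *)
pose B v := A (nth i0 s (index v theta)).
apply: (@nebula_embedding e H T theta B L) => // [v|u v uv|x y z xy yz].
- exact: A0.
- by apply: smA; have /(pairwiseP i0) := ps; apply; rewrite ?inE ?index_lt.
- by apply: rich; apply: subseq_nth3.
Qed.

Lemma nebulas_pure_pair (e1 e2 : pattern) (H1 H2 : tournament) :
  compatible e1 e2 -> pattern_nebula e1 H1 -> pattern_nebula e2 H2 ->
  exists K, forall T : tournament, ~ contains T H1 -> ~ contains T H2 ->
    forall Y : {set T}, 1 < #|Y| -> pure_pair K Y.
Proof.
move=> e12 neb1 neb2; have [N hN] := ramsey3 #|H1|.+1 #|H2|.+1.
(* [M] is the shrinking factor of [stable_subfamily]; a chain of smoothness [L * M] is still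
   [L]-smooth afterwards, and [L] is large enough to embed either nebula. *)
pose M := 2 ^ #|{: pattern * ('I_N * 'I_N * 'I_N)}|.
have M0 : 0 < M by rewrite expn_gt0.
pose L := 2 * (#|H1| + #|H2|).
have [C hC] := smooth_chain H1 (L * M) N.
(* [C] serves sets with fewer than [C] vertices, where the two ends of an arc suffice; [4 * (C * M)]
   comes from [two_free_pure]. *)
exists (C + 4 * (C * M)) => T no1 no2 Y Y1.
have [small|big] := ltnP #|Y| C.
  have /card_gt1P[u [v [uY vY uv]]] := Y1.
  have pp a b : a \in Y -> b \in Y -> arc a b -> pure_pair (C + 4 * (C * M)) Y.
    move=> aY bY ab; exists [set a], [set b]; rewrite !sub1set !cards1.
    by split=> //; [lia | lia | move=> x y /set1P-> /set1P->].
  have := arc_tour uv; have [uv' _|_] := boolP (arc u v); first exact: pp uv'.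
  by move=> vu; exact: pp vu.
have [A [hA smA]] := hC T no1 Y big.
have [A' [hA' st]] := stable_subfamily (fun i : 'I_N => A i).
have cA' i : #|Y| <= C * M * #|A' i|.
  have [_ c] := hA i (ltn_ord i); have [_ c'] := hA' i.
  by rewrite -mulnA; apply: leq_trans c _; rewrite leq_mul2l c' orbT.
have A'0 i : A' i != set0.
  by rewrite -cards_eq0; apply: contraTneq (cA' i) => ->; rewrite muln0; lia.
have sA'Y i : A' i \subset Y.
  by have [s _] := hA i (ltn_ord i); have [s' _] := hA' i; exact: subset_trans s' s.
have smA' (i j : 'I_N) : i < j -> smooth L (A' i) (A' j).
  move=> ij; have [s c] := hA' i; have [s' c'] := hA' j.
  by apply: smooth_sub (smA i j ij (ltn_ord j)) s s' c c'.
have ltP (i j k : 'I_N) s : subseq s (enum 'I_N) -> subseq [:: i; j; k] s -> i < j < k.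
  move=> sub_s /subseq_trans/(_ sub_s) sub3.
  by have := subseq_pairwise sub3 (enum_ord_increasing N); rewrite /= !andbT =>
    /andP[/andP[-> _] ->].
(* A triple free of both patterns yields the pure pair at once; otherwise every increasing triple
   contains, hence is rich in, one of them. *)
have [/existsP[[[i j] k] /= /and3P[/andP[ij jk] f1 f2]]|no] := boolP [exists t : 'I_N * 'I_N * 'I_N,
    [&& t.1.1 < t.1.2 < t.2, pattern_free e1 (A' t.1.1) (A' t.1.2) (A' t.2) &
        pattern_free e2 (A' t.1.1) (A' t.1.2) (A' t.2)]].
  have [[dij _ _] [djk _ _] [dik _ _]] :=
    And3 (smA' i j ij) (smA' j k jk) (smA' i k (ltn_trans ij jk)).
  have [|P [Q [sP sQ cP cQ h]]] := @two_free_pure T (C * M) e1 e2 Y (A' i) (A' j) (A' k)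
    e12 _ (And3 dij dik djk) (And3 (sA'Y i) (sA'Y j) (sA'Y k))
    (And3 (cA' i) (cA' j) (cA' k)) f1 f2; first lia.
  exists P, Q; split=> //; rewrite mulnDl.
    exact: leq_trans cP (leq_addl _ _).
  exact: leq_trans cQ (leq_addl _ _).
have rich e (i j k : 'I_N) : i < j < k -> ~~ pattern_free e (A' i) (A' j) (A' k) ->
    pattern_rich e (A' i) (A' j) (A' k).
  by move=> ijk nf; case: (st e i j k ijk) nf => // ->.
(* Triples are coloured by whether they contain [e1]. In the second outcome all triples of [s] are
   free of [e1], hence rich in [e2]. *)
have [|s [sub_s [[le_s hs]|[le_s hs]]]] := hN _ (fun i j k : 'I_N =>
    ~~ pattern_free e1 (A' i) (A' j) (A' k)) (enum 'I_N); first by rewrite size_enum_ord.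
- case: no1; apply: (@homogeneous_embedding e1 H1 T N L A' s) => //; first by rewrite /L; lia.
  by move=> i j k ijk; apply: rich; [exact: ltP ijk | exact: hs].
- case: no2; apply: (@homogeneous_embedding e2 H2 T N L A' s) => //; first by rewrite /L; lia.
  move=> i j k ijk; apply: rich; first exact: ltP ijk.
  have := hs i j k ijk; rewrite negbK => f1; apply/negP => f2.
  by move/existsPn/(_ (i, j, k)): no; rewrite /= (ltP _ _ _ _ sub_s ijk) f1 f2.
Qed.

(** * From pure pairs to transitive subtournaments *)

(** Every arc raises the index in [s], so a directed cycle would make an index smaller than
    itself. *)
Lemma pairwise_arc_transitive (T : tournament) (s : seq T) :
  pairwise arc s -> transitive_tournament (induced [set x in s]).
Proof.
move=> ps; pose r (u v : T) := index u s < index v s.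
have arc_lt u v : u \in s -> v \in s -> arc u v -> r u v.
  move=> us vs uv; rewrite /r ltnNge; apply/negP; rewrite leq_eqVlt => /orP[/eqP e|lt].
    have vu : v = u by rewrite -(nth_index u vs) e nth_index.
    by rewrite vu arc_irr in uv.
  have := pairwiseP u ps _ _ _ _ lt; rewrite !inE !index_mem !nth_index // => /(_ vs us) vu.
  have neq : u != v by apply: contraTneq uv => ->; rewrite arc_irr.
  by move: (arc_tour neq); rewrite uv vu.
case=> // x c /andP[/= cyc _].
have rtrans : transitive (fun u v : {x : T | x \in [set x in s]} => r (val u) (val v)).
  by move=> v u w; exact: ltn_trans.
have : path (fun u v : {x : T | x \in [set x in s]} => r (val u) (val v)) x (rcons c x).
  apply: sub_path cyc => u v; apply: arc_lt.
    by have := valP u; rewrite inE.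
  by have := valP v; rewrite inE.
move/(order_path_min rtrans)/allP/(_ x); rewrite mem_rcons inE eqxx /r ltnn.
by move=> /(_ isT).
Qed.

Import Order.TTheory GRing.Theory Num.Theory.
Local Open Scope ring_scope.

(** Chains found in [A] and in [B] are concatenated. The exponent [1/K] works because [K < 2 ^ K]:
    shrinking a set by a factor [K] at most halves its power, and two halves add up. *)
Lemma pure_pair_chain (R : realType) (T : tournament) (K : nat) : (0 < K)%N ->
  (forall Y : {set T}, (1 < #|Y|)%N -> pure_pair K Y) ->
  forall Y : {set T}, exists s : seq T, [/\ {subset s <= Y}, pairwise arc s &
    #|Y|%:R `^ K%:R^-1 <= ((size s)%:R : R)].
Proof.
move=> K0 pureT Y; have [n] := ubnP #|Y|; elim: n Y => // n IH Y; rewrite ltnS => leY.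
have k0 : (K%:R : R) != 0 by rewrite pnatr_eq0 -lt0n.
have kpos : 0 <= (K%:R : R)^-1 by rewrite invr_ge0.
case: (ltngtP #|Y| 1%N) => [|Y1|/eqP/cards1P[x Yx]].
(* The empty set is harmless because the exponent is nonzero, which makes the power of zero equal to
   zero. *)
- rewrite ltnS leqn0 => /eqP ->; exists [::]; split=> //.
  by rewrite powR0 // invr_eq0.
- have [A [B [sA sB cA cB pAB]]] := pureT Y Y1.
  have dAB : [disjoint A & B].
    by rewrite -setI_eq0; apply/eqP/setP => x; rewrite !inE; apply/negP => /andP[xA xB];
       have := pAB x x xA xB; rewrite arc_irr.
  have leAB : (#|A| + #|B| <= #|Y|)%N.
    rewrite -cardsUI (disjoint_setI0 dAB) cards0 addn0.
    by apply: subset_leq_card; rewrite subUset sA.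
  have A0 : (0 < #|A|)%N by case: (#|A|) cA => //; rewrite muln0; lia.
  have B0 : (0 < #|B|)%N by case: (#|B|) cB => //; rewrite muln0; lia.
  have [|sa [ssa psa csa]] := IH A; first by lia.
  have [|sb [ssb psb csb]] := IH B; first by lia.
  exists (sa ++ sb); split.
  + by move=> x; rewrite mem_cat => /orP[/ssa/(subsetP sA)|/ssb/(subsetP sB)].
  + rewrite pairwise_cat psa psb !andbT; apply/allrelP => x y /ssa xA /ssb yB.
    exact: pAB.
  + have half (X : {set T}) : (#|Y| <= K * #|X|)%N ->
        #|Y|%:R `^ K%:R^-1 <= 2 * (#|X|%:R : R) `^ K%:R^-1.
      move=> cX; apply: le_trans (_ : (K * #|X|)%:R `^ K%:R^-1 <= _).
        by apply: ge0_ler_powR; rewrite ?nnegrE ?ler0n ?ler_nat.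
      rewrite natrM powRM ?ler0n // ler_wpM2r ?powR_ge0 //.
      apply: le_trans (_ : (2 ^+ K) `^ K%:R^-1 <= _).
        apply: ge0_ler_powR; rewrite ?nnegrE ?ler0n ?exprn_ge0 //.
        by rewrite -natrX ler_nat ltnW // ltn_expl.
      by rewrite -powR_mulrn ?ler0n // -powRrM divff // powRr1 ?ler0n.
    rewrite size_cat natrD; have := half A cA; have := half B cB.
    move: csa csb; lra.
- exists [:: x]; rewrite Yx cards1 powR1; split=> // y; rewrite inE => /eqP ->.
  by rewrite inE eqxx.
Qed.

Unset Implicit Arguments.

(** * The Erdos-Hajnal property for the three pairs of nebulas *)

Definition erdos_hajnal_pair (R : realType) (H1 H2 : tournament) : Prop :=
  exists kappa : R, 0 < kappa /\
    forall T : tournament, ~ contains T H1 -> ~ contains T H2 ->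
      exists X : {set T}, transitive_tournament (induced X) /\
        #|T|%:R `^ kappa <= (#|X|%:R : R).

Lemma erdos_hajnal_pair_sym (R : realType) (H1 H2 : tournament) :
  erdos_hajnal_pair R H1 H2 -> erdos_hajnal_pair R H2 H1.
Proof. by case=> kappa [k0 h]; exists kappa; split=> // T ? ?; exact: h. Qed.

Lemma nebulas_erdos_hajnal (R : realType) (e1 e2 : pattern) (H1 H2 : tournament) :
  compatible e1 e2 -> pattern_nebula e1 H1 -> pattern_nebula e2 H2 ->
  erdos_hajnal_pair R H1 H2.
Proof.
move=> e12 neb1 neb2; have [K hK] := nebulas_pure_pair e12 neb1 neb2.
(* [K.+1] replaces [K], which is not known to be positive. *)
exists (K.+1%:R^-1); split=> [|T no1 no2]; first by rewrite invr_gt0 ltr0n.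
have [|s [_ ps cs]] := @pure_pair_chain R T K.+1 isT _ [set: T].
  move=> Y /(hK T no1 no2 Y)[A [B [sA sB cA cB pAB]]].
  by exists A, B; split=> //; rewrite mulSn; lia.
exists [set x in s]; split; first exact: pairwise_arc_transitive.
rewrite cardsT in cs; apply: le_trans cs _; rewrite ler_nat cardsE.
have us : uniq s by apply: pairwise_uniq ps => x; exact: arc_irr.
by rewrite (card_uniqP us).
Qed.

Theorem mainTheorem1 (R : realType) (H1 H2 : tournament)
  (hH : [\/ (left_nebula H1 /\ right_nebula H2) \/
              (left_nebula H2 /\ right_nebula H1),
            (left_nebula H1 /\ central_nebula H2) \/
              (left_nebula H2 /\ central_nebula H1)
          | (right_nebula H1 /\ central_nebula H2) \/
              (right_nebula H2 /\ central_nebula H1)]) :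
  exists kappa : R, 0 < kappa /\
    forall T : tournament, ~ contains T H1 -> ~ contains T H2 ->
      exists X : {set T}, transitive_tournament (induced X) /\
        #|T|%:R `^ kappa <= (#|X|%:R : R).
Proof.
have left H := @nebula_pattern _ left_pattern H left_star_pattern.
have right H := @nebula_pattern _ _ H right_star_pattern.
have central H := @nebula_pattern _ _ H (fun T th _ => @central_star_pattern T th).
change (erdos_hajnal_pair R H1 H2).
(* [compatible] lists each pair of patterns in one order, so the swapped alternatives go through
   [erdos_hajnal_pair_sym]. *)
case: hH => -[[n1 n2]|[n1 n2]].
- exact: (@nebulas_erdos_hajnal R left_pattern right_pattern _ _ isT
    (left _ n1) (right _ n2)).
- apply: erdos_hajnal_pair_sym.
  exact: (@nebulas_erdos_hajnal R left_pattern right_pattern _ _ isT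
    (left _ n1) (right _ n2)).
- exact: (@nebulas_erdos_hajnal R left_pattern central_pattern _ _ isT
    (left _ n1) (central _ n2)).
- apply: erdos_hajnal_pair_sym.
  exact: (@nebulas_erdos_hajnal R left_pattern central_pattern _ _ isT
    (left _ n1) (central _ n2)).
- exact: (@nebulas_erdos_hajnal R right_pattern central_pattern _ _ isT
    (right _ n1) (central _ n2)).
- apply: erdos_hajnal_pair_sym.
  exact: (@nebulas_erdos_hajnal R right_pattern central_pattern _ _ isT
    (right _ n1) (central _ n2)).
Qed.
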